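(* Let $q(x)\in\mathbb{Q}[x]$ be a polynomial of degree $d\ge1$ with non-constant term. For integers $m\ge0$, $r\ge0$ and $n\ge1$, \[ \Sigma^r q(n)^m=\sum_{j=0}^m(-1)^j\binom{2m+1}{j}\,\Sigma^r C^P_{(m-j)\,q(n)}. \]
   Context: For integers $n,k\ge0$ let $T_k(n)=\binom{n+k+1}{2k+1}+\binom{n+k}{2k+1}$ and $P_n(x)=\sum_{k=0}^n T_k(n)x^k$. For a polynomial $q$ and integer $m\ge0$ define $\Sigma^0 q(n)^m=q(n)^m$ and $\Sigma^{r+1}q(n)^m=\Sigma^r q(1)^m+\Sigma^r q(2)^m+\cdots+\Sigma^r q(n)^m$; similarly $\Sigma^0 C^P_{m\,q(n)}=P_m(q(n))$ and $\Sigma^{r+1}C^P_{m\,q(n)}=\Sigma^r C^P_{m\,q(1)}+\Sigma^r C^P_{m\,q(2)}+\cdots+\Sigma^r C^P_{m\,q(n)}$. *)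

(* Defs.v *)
From mathcomp Require Import all_boot all_order all_algebra.

Set Implicit Arguments.
Unset Strict Implicit.
Unset Printing Implicit Defensive.

Import GRing.Theory.
Local Open Scope ring_scope.

Definition T (k n : nat) : nat :=
  ('C(n + k + 1, 2 * k + 1) + 'C(n + k, 2 * k + 1))%N.

Definition P (n : nat) : {poly rat} := \sum_(k < n.+1) (T k n)%:R *: 'X^k.

Fixpoint Sigma (r : nat) (f : nat -> rat) (n : nat) : rat :=
  if r is r'.+1 then \sum_(1 <= i < n.+1) Sigma r' f i else f n.

Definition SigmaPow (r : nat) (q : {poly rat}) (m n : nat) : rat :=
  Sigma r (fun i => q.[i%:R] ^+ m) n.

Definition SigmaCP (r : nat) (m : nat) (q : {poly rat}) (n : nat) : rat :=
  Sigma r (fun i => (P m).[q.[i%:R]]) n.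

(* Main.v *)
Require Import Defs.
From mathcomp Require Import all_boot all_order all_algebra.
From mathcomp Require Import zify ring.

Set Implicit Arguments.
Unset Strict Implicit.
Unset Printing Implicit Defensive.

Import GRing.Theory.
Local Open Scope ring_scope.

(** The polynomials satisfy [x P_(n+1) = P_(n+2) - 2 P_(n+1) + P_n], also at the
    boundary if one puts [P_(-1) = - P_0].  So multiplication by [x] is a second
    difference in the index, and iterating it [m] times from [P_0 = 1] expresses
    [x^m] in the [P_i]; folding the negative indices back by the antisymmetry
    [P_(-1-i) = - P_i] turns the coefficients [C(2m, _)] into [C(2m+1, _)].
    The theorem follows since [Sigma] is linear. *)

Lemma T_small (k n : nat) : (n < k)%N -> T k n = 0%N.
Proof. by move=> ltnk; rewrite /T !bin_small //; lia. Qed.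

Lemma T0n (n : nat) : T 0 n = n.*2.+1.
Proof. by rewrite /T muln0 add0n !bin1; lia. Qed.

(** Pascal's rule twice: each difference in the upper index lowers both indices by one. Terms are
    moved across to avoid subtraction in [nat]. *)
Lemma binS_second_difference (N M : nat) :
  ('C(N.+2, M.+2) + 'C(N, M.+2) = 'C(N, M) + 2 * 'C(N.+1, M.+2))%N.
Proof. by rewrite !binS; lia. Qed.

(** One instance of [binS_second_difference] for each of the two binomials in [T]. *)
Lemma T_rec (k n : nat) :
  (T k.+1 n.+2 + T k.+1 n = T k n.+1 + 2 * T k.+1 n.+1)%N.
Proof.
have := binS_second_difference (n + k + 2) (2 * k + 1).
have := binS_second_difference (n + k + 1) (2 * k + 1).
rewrite /T.
have -> : (2 * k.+1 + 1 = (2 * k + 1).+2)%N by lia.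
have -> : (n.+2 + k.+1 + 1 = (n + k + 2).+2)%N by lia.
have -> : (n.+2 + k.+1 = (n + k + 1).+2)%N by lia.
have -> : (n + k.+1 + 1 = n + k + 2)%N by lia.
have -> : (n + k.+1 = n + k + 1)%N by lia.
have -> : (n.+1 + k + 1 = n + k + 2)%N by lia.
have -> : (n.+1 + k = n + k + 1)%N by lia.
have -> : (n.+1 + k.+1 + 1 = (n + k + 2).+1)%N by lia.
have -> : (n.+1 + k.+1 = (n + k + 1).+1)%N by lia.
lia.
Qed.

Lemma coef_P (n k : nat) : (P n)`_k = (T k n)%:R.
Proof.
rewrite /P -(poly_def _ (fun k => (T k n)%:R)) coef_poly ltnS.
by case: leqP => // ltnk; rewrite T_small.
Qed.

Lemma P0 : P 0 = 1.
Proof.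
apply/polyP => -[|k]; rewrite coef_P coef1 ?T0n //.
by rewrite T_small.
Qed.

Lemma mulX_P0 : 'X * P 0 = P 1 - P 0 *+ 3.
Proof.
apply/polyP => k; rewrite coefXM coefB coefMn !coef_P.
case: k => [|[|k]]; rewrite /= ?T0n.
- by [].
- by rewrite (@T_small 1 0) // mul0rn subr0.
- by rewrite !T_small // mul0rn subr0.
Qed.

Lemma mulX_P (n : nat) : 'X * P n.+1 = P n.+2 - P n.+1 *+ 2 + P n.
Proof.
apply/polyP => k; rewrite coefXM coefD coefB coefMn !coef_P.
case: k => [|k] /=.
  (* The constant coefficients [2n+1] are in arithmetic progression, so their second difference
     vanishes. *)
  by rewrite !T0n -!addnn -!natr1 !natrD -!natr1; ring.
have /(congr1 (fun i => i%:R : rat)) := T_rec k n.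
rewrite (natrD _ (T k.+1 n.+2)) (natrD _ (T k n.+1)) natrM => E.
by rewrite addrAC E; ring.
Qed.

(* [p 1 - p 0 *+ 3] is [p 1 - p 0 *+ 2 + p (-1)] with [p (-1) = - p 0]. *)
Lemma expr_second_difference (R : comNzRingType) (x : R) (p : nat -> R) :
    p 0 = 1 -> x * p 0 = p 1 - p 0 *+ 3 ->
    (forall n, x * p n.+1 = p n.+2 - p n.+1 *+ 2 + p n) ->
  forall m, x ^+ m =
    \sum_(j < m.+1) (-1) ^+ j * ('C(2 * m + 1, j))%:R * p (m - j)%N.
Proof.
move=> p0 hp0 hp; elim=> [|m IHm].
  by rewrite big_ord1 bin0 p0 !mulr1.
pose c j : R := (-1) ^+ j * ('C(2 * m + 1, j))%:R.
have binE : (2 * m.+1 + 1 = (2 * m + 1).+2)%N by lia.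
(* Passing from [m] to [m.+1] adds two to the binomial row; with the signs, Pascal's rule becomes a
   second difference of [c]. *)
have cE j : (-1) ^+ j.+2 * ('C(2 * m.+1 + 1, j.+2))%:R
    = c j.+2 - c j.+1 *+ 2 + c j.
  by rewrite /c binE !binS !natrD !exprS; ring.
have c0 : c 0 = 1 by rewrite /c bin0 mulr1.
have c1 : (-1) ^+ 1 * ('C(2 * m.+1 + 1, 1))%:R = c 1 - c 0 *+ 2.
  by rewrite c0 /c binE !bin1 -!natr1; ring.
(* The two middle binomials of an odd row are equal, with opposite signs. *)
have c_mid : c m.+1 = - c m.
  rewrite /c -(@bin_sub _ m.+1); last by lia.
  have -> : (2 * m + 1 - m.+1 = m)%N by lia.
  by rewrite exprS; ring.
(* Summation by parts: one sum is split at its last two terms and at its first two. [S2] does the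
   same with one term. *)
have S1 : \sum_(j < m) c j * p (m - j.+1).+2 + c m * p 1 + c m.+1 * p 0
    = p m.+1 + c 1 * p m + \sum_(j < m) c j.+2 * p (m - j.+1)%N.
  transitivity (\sum_(j < m.+2) c j * p (m.+1 - j)%N).
    rewrite !big_ord_recr /= subnn subSn // subnn; congr (_ + _ + _).
    apply: eq_bigr => j _; congr (_ * p _).
    by have := ltn_ord j; lia.
  rewrite !big_ord_recl /= c0 mul1r subn0 addrA /bump /= !add1n subSS subn0.
  by congr (_ + _ + _); apply: eq_bigr => j _; rewrite /bump /= !add1n subSS.
have S2 : \sum_(j < m) c j * p (m - j.+1).+1 + c m * p 0
    = p m + \sum_(j < m) c j.+1 * p (m - j.+1)%N.
  transitivity (\sum_(j < m.+1) c j * p (m - j)%N).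
    rewrite big_ord_recr /= subnn; congr (_ + _).
    apply: eq_bigr => j _; congr (_ * p _).
    by have := ltn_ord j; lia.
  by rewrite big_ord_recl c0 mul1r subn0.
(* The term [j = m] carries [p 0] and needs the boundary relation; all others use [hp]. *)
have -> : x ^+ m.+1 = \sum_(j < m) c j * p (m - j.+1).+2
    - (\sum_(j < m) c j * p (m - j.+1).+1) *+ 2
    + \sum_(j < m) c j * p (m - j.+1)%N + c m * (p 1 - p 0 *+ 3).
  rewrite exprS IHm mulr_sumr big_ord_recr /= subnn -/(c m) mulrCA hp0.
  congr (_ + _); rewrite -sumrMnl -sumrB -big_split /=.
  apply: eq_bigr => j _; rewrite -/(c j) mulrCA.
  have -> : (m - j = (m - j.+1).+1)%N by have := ltn_ord j; lia.
  by rewrite hp; ring.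
have -> : \sum_(j < m.+2) (-1) ^+ j * ('C(2 * m.+1 + 1, j))%:R * p (m.+1 - j)%N
    = p m.+1 + (c 1 - c 0 *+ 2) * p m + (\sum_(j < m) c j.+2 * p (m - j.+1)%N
    - (\sum_(j < m) c j.+1 * p (m - j.+1)%N) *+ 2
    + \sum_(j < m) c j * p (m - j.+1)%N).
  rewrite !big_ord_recl /= bin0 !mul1r subn0 addrA /bump /= !add1n subSS subn0.
  rewrite c1; congr (_ + _); rewrite -sumrMnl -sumrB -big_split /=.
  by apply: eq_bigr => j _; rewrite /bump /= !add1n cE subSS; ring.
rewrite c_mid in S1; rewrite c0.
(* The leftover terms [c m * p 1 - c m * p 0] from [S1] and [- c m * p 0 *+ 2] from [S2] add up to
   the boundary term with its factor 3. *)
have -> : \sum_(j < m) c j.+2 * p (m - j.+1)%N =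
    \sum_(j < m) c j * p (m - j.+1).+2 + c m * p 1 + - c m * p 0
    - (p m.+1 + c 1 * p m) by rewrite S1; ring.
have -> : \sum_(j < m) c j.+1 * p (m - j.+1)%N =
    \sum_(j < m) c j * p (m - j.+1).+1 + c m * p 0 - p m by rewrite S2; ring.
ring.
Qed.

Lemma expr_horner_P (x : rat) (m : nat) :
  x ^+ m =
  \sum_(j < m.+1) (-1) ^+ j * ('C(2 * m + 1, j))%:R * (P (m - j)).[x].
Proof.
apply: (@expr_second_difference _ x (fun n => (P n).[x])) => [||n].
- by rewrite P0 hornerC.
- by have /(congr1 (horner^~ x)) := mulX_P0;
     rewrite hornerM hornerX hornerD hornerN hornerMn.
- by have /(congr1 (horner^~ x)) := mulX_P n;
     rewrite hornerM hornerX !hornerD hornerN hornerMn.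
Qed.

Lemma eq_Sigma (r : nat) (f g : nat -> rat) (n : nat) :
  f =1 g -> Sigma r f n = Sigma r g n.
Proof.
move=> fg; elim: r n => [|r IHr] n //=.
by apply: eq_bigr => i _; apply: IHr.
Qed.

Lemma Sigma_sum (I : Type) (s : seq I) (c : I -> rat) (f : I -> nat -> rat)
    (r n : nat) :
  Sigma r (fun i => \sum_(j <- s) c j * f j i) n =
  \sum_(j <- s) c j * Sigma r (f j) n.
Proof.
elim: r n => [|r IHr] n //=.
under eq_bigr do rewrite IHr.
by rewrite exchange_big; apply: eq_bigr => j _; rewrite mulr_sumr.
Qed.

Theorem theorem1 (q : {poly rat}) (d : nat) (hd : (1 <= d)%N)
    (hq : size q = d.+1) (hnc : exists2 i : nat, (0 < i)%N & q`_i != 0)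
    (m r n : nat) (hn : (1 <= n)%N) :
  SigmaPow r q m n =
  \sum_(0 <= j < m.+1)
    (-1) ^+ j * ('C(2 * m + 1, j))%:R * SigmaCP r (m - j) q n.
Proof.
(* Linearity reduces the claim to the pointwise expansion at [q.[i%:R]]. *)
rewrite -Sigma_sum; apply: eq_Sigma => i.
by rewrite expr_horner_P big_mkord.
Qed.
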